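(* For every interval graph $G$, the functionality of $G$ satisfies $\mathrm{fun}(G)\le 8$.
   Context: All graphs are finite, undirected, without loops and multiple edges. An interval graph is the intersection graph of (finitely many) intervals on the real line: each vertex can be associated with an interval so that two distinct vertices are adjacent if and only if the corresponding intervals intersect. Let $G$ be a graph with adjacency matrix $A$. A vertex $y\in V(G)$ is a function of vertices $x_1,\ldots,x_k\in V(G)\setminus\{y\}$ if there is a Boolean function $f$ of $k$ variables such that for every vertex $z\in V(G)$ different from $y,x_1,\ldots,x_k$ we have $A(y,z)=f(A(z,x_1),\ldots,A(z,x_k))$. The minimum $k$ (with $k=0$ allowed, in which case $f$ is a constant) such that $y$ is a function of $k$ other vertices is the functionality of $y$ in $G$, denoted $\mathrm{fun}_G(y)$. The functionality of $G$ is $$\mathrm{fun}(G)=\max_H\min_{y\in V(H)}\mathrm{fun}_H(y),$$ where the maximum is over all (nonempty) induced subgraphs $H$ of $G$. *)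

(* Defs.v *)
From HB Require Import structures.
From mathcomp Require Import all_boot all_order all_algebra.
From mathcomp Require Import reals.

Set Implicit Arguments.
Unset Strict Implicit.
Unset Printing Implicit Defensive.

Record sgraph := SGraph {
  vertex :> finType;
  adj : rel vertex;
  adj_sym : symmetric adj;
  adj_irrefl : irreflexive adj }.

Section Induced.
Variables (G : sgraph) (S : {set G}).

Definition induced_adj : rel {x : G | x \in S} :=
  fun x y => adj (val x) (val y).

Lemma induced_adj_sym : symmetric induced_adj.
Proof. by move=> x y; apply: adj_sym. Qed.

Lemma induced_adj_irrefl : irreflexive induced_adj.
Proof. by move=> x; apply: adj_irrefl. Qed.

Definition induced : sgraph := SGraph induced_adj_sym induced_adj_irrefl.

End Induced.

(* Both the vertices [x_1, ..., x_k] and the Boolean function [f] range over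
   finite types, so the notion is decidable and can be minimized over [k]. *)
Definition function_of (G : sgraph) (y : G) (k : nat) (xs : k.-tuple G) : bool :=
  (y \notin xs) &&
  [exists f : {ffun k.-tuple bool -> bool},
    [forall z : G, (z != y) && (z \notin xs) ==>
                   (adj y z == f [tuple of [seq adj z x | x <- xs]])]].

Definition function_of_some (G : sgraph) (y : G) : pred nat :=
  fun k => [exists xs : k.-tuple G, function_of y xs].

(* All the other vertices always do. *)
Lemma function_of_some_card (G : sgraph) (y : G) :
  function_of_some y #|[set~ y]|.
Proof.
apply/existsP; exists (enum_tuple [set~ y]); rewrite /function_of.
rewrite mem_enum !inE eqxx /=.
apply/existsP; exists [ffun=> false]; apply/forallP => z.
by rewrite mem_enum !inE; case: (z == y).
Qed.

Lemma function_of_some_ex (G : sgraph) (y : G) : exists k, function_of_some y k.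
Proof. by exists #|[set~ y]|; apply: function_of_some_card. Qed.

Definition vertex_functionality (G : sgraph) (y : G) : nat :=
  ex_minn (function_of_some_ex y).

(* Every vertex of [H] has functionality at most [#|H| - 1], so the initial
   value [#|H|] never affects the minimum when [H] is nonempty. *)
Definition min_functionality (H : sgraph) : nat :=
  \big[minn/#|H|]_(y : H) vertex_functionality y.

Definition functionality (G : sgraph) : nat :=
  \max_(S : {set G} | S != set0) min_functionality (induced S).

(* [interval R] covers open, closed, half-open and unbounded intervals; a vertex
   with an empty interval is isolated, which does not enlarge the class. *)
Definition interval_graph (R : realType) (G : sgraph) : Prop :=
  exists I : G -> interval R,
    forall x y : G, x != y ->
      adj x y <-> exists r : R, r \in I x /\ r \in I y.

(* Main.v *)
(* For intervals, x wholly to the left of y defines an interval order P, and two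
   distinct vertices are adjacent iff they are P-incomparable.  The sets of
   predecessors form a chain, and so do the sets of successors; let p(y) and
   q(y) be their sizes.  Suppose that x1 has |p(x1) - p(y)| <= 3 and
   q(x1) <= q(y), and that x2 has |q(x2) - q(y)| <= 3 and p(x2) <= p(y).  Outside
   the at most 6 vertices where the predecessors of x1 and y or the successors
   of x2 and y differ, z is adjacent to y iff it is adjacent to both x1 and x2,
   so y has functionality at most 8.  Any two distinct vertices lacking an x1
   have values of p at least 4 apart, so about n/4 vertices lack an x1;
   similarly about n/4 lack an x2, and some vertex has both. *)

Require Import Defs.
From mathcomp Require Import all_boot all_order all_algebra.
From mathcomp Require Import reals.
From mathcomp Require Import boolp zify.

Set Implicit Arguments.
Unset Strict Implicit.
Unset Printing Implicit Defensive.

Import Order.TTheory.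

Lemma bigminn_le (T : finType) (F : T -> nat) (m : nat) (y : T) :
  \big[minn/m]_(x : T) F x <= F y.
Proof.
have: y \in index_enum T by rewrite mem_index_enum.
elim: (index_enum T) => // x s IHs; rewrite big_cons inE geq_min.
by case/predU1P => [->|/IHs ->]; rewrite ?leqnn ?orbT.
Qed.

Lemma vertex_functionality_le (G : sgraph) (y : G) (k : nat) :
  function_of_some y k -> vertex_functionality y <= k.
Proof. by rewrite /vertex_functionality; case: ex_minnP => m _; apply. Qed.

(** Lists replace tuples here, so that the number of arguments can be the size of a list built
    during the proof. *)
Lemma function_of_some_seq (G : sgraph) (y : G) (xs : seq G)
    (f : seq bool -> bool) :
  y \notin xs ->
  (forall z, z != y -> z \notin xs -> adj y z = f [seq adj z x | x <- xs]) ->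
  function_of_some y (size xs).
Proof.
move=> yxs yf; apply/existsP; exists (in_tuple xs).
rewrite /function_of yxs; apply/existsP.
exists [ffun t : (size xs).-tuple bool => f t]; apply/forallP => z.
by apply/implyP => /andP[zy zxs]; rewrite ffunE (yf z zy zxs).
Qed.

Definition symdiff (T : finType) (A B : {set T}) := (A :\: B) :|: (B :\: A).

Lemma notin_symdiff (T : finType) (A B : {set T}) (z : T) :
  z \notin symdiff A B -> (z \in A) = (z \in B).
Proof. by rewrite !inE; case: (z \in A); case: (z \in B). Qed.

(** With irreflexivity this characterizes interval orders; transitivity is the case [b = c]. *)
Definition two_two_free (T : finType) (P : rel T) :=
  forall a b c d, P a b -> P c d -> P a d || P c b.

Definition below (T : finType) (P : rel T) (y : T) := [set z | P z y].

Definition converse (T : finType) (P : rel T) : rel T := fun x y => P y x.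

Lemma two_two_free_converse (T : finType) (P : rel T) :
  two_two_free P -> two_two_free (converse P).
Proof. by move=> P22 a b c d Pba Pdc; rewrite orbC; apply: P22. Qed.

(** Predecessor sets form a chain: if [a] precedes only [x] and [c] only [y], then [P a x] and
    [P c y] violate [two_two_free]. Hence sizes decide inclusion. *)
Lemma below_sub (T : finType) (P : rel T) (x y : T) :
  two_two_free P -> #|below P x| <= #|below P y| -> below P x \subset below P y.
Proof.
move=> P22 le_xy; case: (boolP (below P y \subset below P x)) => [s|].
  by rewrite (eqP (_ : below P y == below P x)) // eqEcard s.
case/subsetPn => c; rewrite !inE => Pcy nPcx.
apply/subsetP => a; rewrite !inE => Pax.
by have := P22 _ _ _ _ Pax Pcy; rewrite (negPf nPcx) orbF.
Qed.

Lemma card_symdiff_below (T : finType) (P : rel T) (d : nat) (x y : T) :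
  two_two_free P ->
  #|below P x| <= #|below P y| + d -> #|below P y| <= #|below P x| + d ->
  #|symdiff (below P x) (below P y)| <= d.
Proof.
move=> P22 xyd yxd; rewrite /symdiff.
have [/(below_sub P22) s|/ltnW/(below_sub P22) s] :=
  leqP #|below P x| #|below P y|.
- by move: (s); rewrite -setD_eq0 => /eqP->; rewrite set0U cardsDS //; lia.
- by move: (s); rewrite -setD_eq0 => /eqP->; rewrite setU0 cardsDS //; lia.
Qed.

Lemma card_below_lt (T : finType) (P : rel T) (y : T) :
  irreflexive P -> #|below P y| < #|T|.
Proof.
move=> Pirr; rewrite -cardsT; apply: proper_card; apply/properP.
by split; [apply: subsetT | exists y; rewrite !inE ?Pirr].
Qed.

Definition near_below (T : finType) (p q : T -> nat) (d : nat) (y x : T) :=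
  [&& x != y, q x <= q y, p x <= p y + d & p y <= p x + d].

(** Cut the values of [p] into blocks of [d.+1] consecutive integers. Of two vertices in the same
    block, the one with the smaller [q] is near the other, so each block contains at most one
    exceptional vertex. *)
Lemma card_no_near_below (T : finType) (p q : T -> nat) (d N : nat) :
  (forall y, p y < N) ->
  #|[set y | ~~ [exists x, near_below p q d y x]]| <= (N + d) %/ d.+1.
Proof.
move=> pN; set B := [set y | _].
have lt_block y : p y %/ d.+1 < (N + d) %/ d.+1.
  have := pN y; have := leq_trunc_div (p y) d.+1.
  by rewrite leq_divRL // mulSn; lia.
pose block y := Ordinal (lt_block y).
rewrite -[leqRHS]card_ord -(card_in_imset (f := block)) ?max_card //.
suff sep y y' : y \in B -> q y' <= q y -> block y = block y' -> y = y'.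
  move=> y y' yB y'B eq_block; have [qy|/ltnW qy] := leqP (q y') (q y).
    exact: sep yB qy eq_block.
  by apply/esym; apply: sep y'B qy (esym eq_block).
rewrite inE negb_exists => /forallP/(_ y') no_near qy [] eq_block.
apply/eqP; apply: contraR no_near => neq; rewrite /near_below eq_sym neq qy /=.
have := divn_eq (p y) d.+1; have := divn_eq (p y') d.+1.
have := ltn_pmod (p y) (ltn0Sn d); have := ltn_pmod (p y') (ltn0Sn d).
rewrite eq_block; lia.
Qed.

Lemma function_of_some_near (G : sgraph) (P : rel G) (d : nat) (y x1 x2 : G) :
  two_two_free P ->
  (forall x z, x != z -> adj x z = ~~ P x z && ~~ P z x) ->
  let p := fun x => #|below P x| in
  let q := fun x => #|below (converse P) x| in
  near_below p q d y x1 -> near_below q p d y x2 ->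
  exists2 k, k <= (d.*2).+2 & function_of_some y k.
Proof.
move=> P22 adjP p q /and4P[x1y qx1 px1 px1'] /and4P[x2y px2 qx2 qx2'].
have P22' := two_two_free_converse P22.
pose D1 := symdiff (below P x1) (below P y).
pose D2 := symdiff (below (converse P) x2) (below (converse P) y).
(* [y] may not be among its own arguments. *)
pose D := (D1 :|: D2) :\ y.
have cardD : #|D| <= d.*2.
  rewrite -addnn; apply: leq_trans (subset_leq_card (subD1set _ _)) _.
  apply: leq_trans (leq_card_setU _ _) _.
  by apply: leq_add; apply: card_symdiff_below.
exists (size [:: x1, x2 & enum D]); first by rewrite /= -cardE.
(* The function reads only [x1] and [x2]; the vertices of [D] are listed just to exempt them from
   the condition. *)
apply: (@function_of_some_seq _ _ _ (fun s => nth false s 0 && nth false s 1)).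
  by rewrite !inE mem_enum !inE eqxx orbF negb_or !(eq_sym y) x1y x2y.
move=> z zy; rewrite !inE mem_enum !negb_or => /and3P[zx1 zx2 zD] /=.
move: zD; rewrite in_setD1 zy in_setU negb_or.
case/andP => /notin_symdiff zD1 /notin_symdiff zD2.
have /subsetP/(_ z) s1 := below_sub P22' qx1.
have /subsetP/(_ z) s2 := below_sub P22 px2.
rewrite !adjP //; last by rewrite eq_sym.
(* Outside [D], [P z y] excludes adjacency to [x1] and [P y z] excludes adjacency to [x2].
   Conversely, [P x1 z] implies [P y z], and [P z x2] implies [P z y]. *)
move: zD1 zD2 s1 s2; rewrite !inE /converse => -> -> s1 s2.
case: (P z y) s2; case: (P y z) s1; rewrite ?andbF //= ?andbT => s1 s2.
by apply/esym/andP; split; apply/negP; [move/s1|move/s2].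
Qed.

Lemma function_of_some_interval_order (G : sgraph) (P : rel G) (d : nat) :
  irreflexive P -> two_two_free P ->
  (forall x z, x != z -> adj x z = ~~ P x z && ~~ P z x) ->
  ((#|G| + d) %/ d.+1).*2 < #|G| ->
  exists y : G, exists2 k, k <= (d.*2).+2 & function_of_some y k.
Proof.
move=> Pirr P22 adjP small.
pose p x := #|below P x|; pose q x := #|below (converse P) x|.
pose B1 := [set y | ~~ [exists x, near_below p q d y x]].
pose B2 := [set y | ~~ [exists x, near_below q p d y x]].
have B1_le : #|B1| <= (#|G| + d) %/ d.+1.
  by apply: card_no_near_below => y; apply: card_below_lt.
have B2_le : #|B2| <= (#|G| + d) %/ d.+1.
  by apply: card_no_near_below => y; apply: card_below_lt.
have [y] : exists y, y \notin B1 :|: B2.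
  apply/existsP; rewrite -negb_forall; apply/negP => /forallP all_bad.
  have: #|[set: G]| <= #|B1 :|: B2|.
    by apply: subset_leq_card; apply/subsetP => y _; apply: all_bad.
  by rewrite cardsT; have := (leq_card_setU B1 B2).1; lia.
rewrite !inE negb_or !negbK => /andP[/existsP[x1 near1] /existsP[x2 near2]].
by exists y; apply: function_of_some_near P22 adjP near1 near2.
Qed.

Lemma itv_convex (R : realType) (i : interval R) (a b c : R) :
  a \in i -> c \in i -> (a <= b)%O -> (b <= c)%O -> b \in i.
Proof.
case: i => l u; rewrite !itv_boundlr => /andP[la _] /andP[_ cu] ab bc.
by rewrite (le_trans la) ?(le_trans _ cu) // bnd_simp.
Qed.

(** This reduces the theorem to finding one vertex of functionality at most 8 in every nonempty
    interval graph. *)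
Lemma interval_graph_induced (R : realType) (G : sgraph) (S : {set G}) :
  interval_graph R G -> interval_graph R (induced S).
Proof. by case=> I hI; exists (fun x => I (val x)) => x y xy; apply: hI. Qed.

Lemma function_of_some_isolated (G : sgraph) (y : G) :
  (forall z, adj y z = false) -> function_of_some y 0.
Proof. by move=> y0; apply: (@function_of_some_seq _ _ [::] xpred0). Qed.

Lemma interval_graph_order (R : realType) (G : sgraph) :
  interval_graph R G -> (forall y : G, exists z, adj y z) ->
  exists P : rel G, [/\ irreflexive P, two_two_free P &
    forall x z, x != z -> adj x z = ~~ P x z && ~~ P z x].
Proof.
case=> I hI nbr.
have I0 x : exists r, r \in I x.
  have [z xz] := nbr x; have [r [rx _]] : exists r, r \in I x /\ r \in I z.
    by apply/hI => //; apply: contraTneq xz => <-; rewrite adj_irrefl.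
  by exists r.
(* An empty interval would satisfy [P x x] vacuously; having a neighbour rules it out. *)
pose P x y := `[< forall r s, r \in I x -> s \in I y -> (r < s)%O >].
(* One pair of points orders two disjoint intervals: if [s <= r] for some [r] in [I x] and [s] in
   [I z], convexity puts the larger of [a] and [s] in both. *)
have disjointP x z a b : a \in I x -> b \in I z -> (a < b)%O ->
    ~ (exists r, r \in I x /\ r \in I z) -> P x z.
  move=> ax bz ab disj; apply/asboolP => r s rx sz; rewrite ltNge.
  apply/negP => sr; apply: disj; have [sa|/ltW ha] := leP s a.
    by exists a; split=> //; apply: itv_convex sz bz sa (ltW ab).
  by exists s; split=> //; apply: itv_convex ax rx ha sr.
exists P; split.
- move=> x; apply/negP => /asboolP Pxx; have [r rx] := I0 x.
  by have := Pxx _ _ rx rx; rewrite ltxx.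
- move=> a b c d /asboolP Pab /asboolP Pcd; apply/orP.
  (* If [P a d] fails, some [s] in [I d] and [r] in [I a] have [s <= r]; then [I c] lies before [s]
     and [I b] after [r]. *)
  have [Pad|/asboolP/existsNP[r /existsNP[s]]] := boolP (P a d); first by left.
  move=> /not_implyP[ra /not_implyP[sd /negP]]; rewrite -leNgt => sr.
  right; apply/asboolP => r' s' r'c s'b.
  exact: lt_trans (Pcd _ _ r'c sd) (le_lt_trans sr (Pab _ _ ra s'b)).
- move=> x z xz; apply/idP/idP => [/(hI _ _ xz)[r [rx rz]]|].
    by apply/andP; split; apply/asboolP => /(_ r r); rewrite ltxx;
       [move/(_ rx rz)|move/(_ rz rx)].
  case/andP => nPxz nPzx; apply/(hI _ _ xz); apply: contrapT => disj.
  have [a ax] := I0 x; have [b bz] := I0 z.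
  have [ab|ba|ab] := ltgtP a b.
  + by rewrite (disjointP x z a b) in nPxz.
  + rewrite (disjointP z x b a) // in nPzx.
    by case=> r [rz rx]; apply: disj; exists r.
  + by apply: disj; exists a; rewrite {2}ab.
Qed.

Lemma interval_graph_function_of_some (R : realType) (G : sgraph) :
  interval_graph R G -> 0 < #|G| ->
  exists y : G, exists2 k, k <= 8 & function_of_some y k.
Proof.
(* Up to 9 vertices, all the others serve as arguments. From 10 on, twice the ceiling of a quarter
   of the order is below the order, as the choice [d = 3] requires; it yields the bound 2 * 3 + 2 =
   8. *)
move=> hG G0; have [G9|G9] := leqP #|G| 9.
  have [y _] := card_gt0P G0; exists y, #|[set~ y]|.
    by rewrite cardsC1; lia.
  exact: function_of_some_card.
have [/existsP[y /existsPn y0]|/existsPn nbr] :=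
  boolP [exists y : G, ~~ [exists z, adj y z]].
  by exists y, 0 => //; apply: function_of_some_isolated => z; apply/negbTE.
have [|P [Pirr P22 adjP]] := interval_graph_order hG.
  by move=> y; apply/existsP; have := nbr y; rewrite negbK.
by apply: (function_of_some_interval_order (d := 3) Pirr P22 adjP); lia.
Qed.

Theorem theorem3p2 (R : realType) (G : sgraph) (hG : interval_graph R G) :
  functionality G <= 8.
Proof.
apply/bigmax_leqP => S S0.
have [|y [k k8 yk]] :=
  interval_graph_function_of_some (interval_graph_induced S hG).
  have [x xS] := set0Pn _ S0.
  by apply/card_gt0P; exists (exist _ x xS).
apply: leq_trans (bigminn_le _ _ y) _.
exact: leq_trans (vertex_functionality_le yk) k8.
Qed.
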